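(* Let $\Psi \colon \mathbb{R}^{2n} \to \mathbb{R}^{2n}$ be an affine map of the form $z \mapsto Az + b$, where $A$ is a real-linear map that preserves $\Omega$ (that is, $A^*\Omega = \Omega$) and $b \in \mathbb{R}^{2n}$. If $\Psi(B(r)) \subseteq Z_L(R)$, where $L$ is any Lagrangian subspace of $\mathbb{R}^{2n}$, then $r \leq R$.
   Context: Identify $\mathbb{C}^n = \mathbb{R}^{2n}$ with coordinates $z^k = x^k + i y^k$, with the standard Euclidean metric and standard symplectic form $\omega = \sum_{k=1}^n dx^k\wedge dy^k$. $\Omega = dz^1\wedge\cdots\wedge dz^n$ is the complex-valued holomorphic volume form, regarded as a complex-valued $n$-form on $\mathbb{R}^{2n}$. A Lagrangian subspace is a real $n$-dimensional subspace $L$ with $\omega|_L = 0$. $r,R>0$ are real numbers, $B(r)$ is the closed ball of radius $r$ centered at the origin in $\mathbb{R}^{2n}$, and $Z_L(R) = \{x\in\mathbb{R}^{2n} : |\mathrm{proj}_L(x)|^2 \leq R^2\}$, where $\mathrm{proj}_L$ is the orthogonal projection onto $L$. *)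

(* Defs.v *)
From HB Require Import structures.
From mathcomp Require Import all_boot all_order all_algebra.
From mathcomp Require Import complex.
From mathcomp Require Import classical_sets reals.

Set Implicit Arguments.
Unset Strict Implicit.
Unset Printing Implicit Defensive.

Import Order.TTheory GRing.Theory Num.Theory.
Local Open Scope ring_scope.
Local Open Scope complex_scope.
Local Open Scope classical_set_scope.

Definition dotv (R : realType) (m : nat) (u v : 'rV[R]_m) : R :=
  \sum_i u 0 i * v 0 i.

(* Not the norm `|_| on matrices, which is the sup norm. *)
Definition enorm (R : realType) (m : nat) (v : 'rV[R]_m) : R :=
  Num.sqrt (dotv v v).

Section DotForm.
Variables (R : realType) (m : nat).
Implicit Types u v : 'rV[R]_m.

Lemma dotvC u v : dotv u v = dotv v u.
Proof. by apply: eq_bigr => i _; rewrite mulrC. Qed.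

Fact dotv_bilinear : bilinear_for *%R *%R (@dotv R m).
Proof.
have lin u a v w : dotv u (a *: v + w) = a * dotv u v + dotv u w.
  rewrite /dotv mulr_sumr -big_split /=.
  by apply: eq_bigr => i _; rewrite !mxE mulrDr mulrCA.
by split=> u a v w; rewrite ?(dotvC _ u) lin ?(dotvC u).
Qed.

HB.instance Definition _ := @bilinear_isBilinear.Build R _ _ R
  *%R (idfun \; *%R) (@dotv R m) dotv_bilinear.

Fact dotv_hermitian u v : dotv u v = (-1) ^+ false * idfun (dotv v u).
Proof. by rewrite mul1r dotvC. Qed.

HB.instance Definition _ := @isHermitianSesquilinear.Build R _ false idfun
  (@dotv R m) dotv_hermitian.

Fact dotv_gt0 u : u != 0 -> 0 < dotv u u.
Proof.
move=> u0; rewrite lt_neqAle eq_sym sumr_ge0 => [|i _]; last exact: sqr_ge0.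
rewrite andbT; apply: contra u0 => /eqP/psumr_eq0P u0; apply/eqP/rowP => i.
have /eqP := u0 (fun i _ => sqr_ge0 (u 0 i)) i isT.
by rewrite mulf_eq0 orbb mxE => /eqP.
Qed.

HB.instance Definition _ := @isDotProduct.Build R _ (@dotv R m) dotv_gt0.

End DotForm.

Definition orthocomp (R : realType) (m : nat) (L : {vspace 'rV[R]_m}) :
    {vspace 'rV[R]_m} :=
  orthov (@dotv R m) L.

Definition proj (R : realType) (m : nat) (L : {vspace 'rV[R]_m}) :
    'End('rV[R]_m) :=
  daddv_pi L (orthocomp L).

Section OrthogonalProjection.
Variables (R : realType) (m : nat) (L : {vspace 'rV[R]_m}).
Implicit Types u v : 'rV[R]_m.

Lemma capv_orthocomp : (L :&: orthocomp L = 0)%VS.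
Proof.
apply/eqP; rewrite -subv0; apply/subvP => u; rewrite memv_cap memv0.
case/andP=> uL /mem_orthovP/(_ u uL) /= uu0.
by apply/negPn/negP => /dotv_gt0; rewrite uu0 ltxx.
Qed.

Lemma addv_orthocomp : (L + orthocomp L = fullv)%VS.
Proof.
apply/eqP; rewrite eqEdim subvf (dimv_disjoint_sum capv_orthocomp) /=.
pose B : 'M[R]_(m, \dim L) := \matrix_(j, i) (vbasis L)`_i 0 j.
pose phi := linfun (mulmxr B) : 'Hom('rV[R]_m, 'rV[R]_(\dim L)).
rewrite -(limg_ker_dim phi) capfv addnC leq_add //.
  by have := dimvS (subvf (limg phi)); rewrite dimvf /dim /= mul1n.
apply: dimvS; apply/subvP => v; rewrite memv_ker lfunE /= => /eqP vB0.
apply/mem_orthovP => u /coord_vbasis ->; rewrite linear_sumr big1 //= => i _.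
rewrite linearZr /=; suff -> : dotv v (vbasis L)`_i = 0 by rewrite mulr0.
have /rowP/(_ i) := vB0; rewrite !mxE => <-.
by apply: eq_bigr => j _; rewrite mxE.
Qed.

Lemma memv_orthoproj v : proj L v \in L.
Proof. exact: memv_pi. Qed.

Lemma orthoproj_orthogonal v : {in L, forall u, dotv (v - proj L v) u = 0}.
Proof.
have vE : v = proj L v + daddv_pi (orthocomp L) L v.
  by rewrite daddv_pi_add ?capv_orthocomp // addv_orthocomp memvf.
by apply/mem_orthovP; rewrite {1}vE addrC addKr; apply: memv_pi.
Qed.

End OrthogonalProjection.

(* R^(2n) is 'rV[R]_(n + n), with coordinates (x^1, ..., x^n, y^1, ..., y^n)
   and z^k = x^k + i y^k. *)
Section SymplecticSpace.
Variables (R : realType) (n : nat).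
Implicit Types u v : 'rV[R]_(n + n).

Definition xcoord (k : 'I_n) v : R := v 0 (lshift n k).

Definition ycoord (k : 'I_n) v : R := v 0 (rshift n k).

Definition omega u v : R :=
  \sum_(k < n) (xcoord k u * ycoord k v - ycoord k u * xcoord k v).

Definition lagrangian (L : {vspace 'rV[R]_(n + n)}) : Prop :=
  \dim L = n /\ {in L &, forall u v, omega u v = 0}.

Definition dz (k : 'I_n) v : R[i] := xcoord k v +i* ycoord k v.

(* The wedge product is normalised without factorials:
   (dz^1 /\ ... /\ dz^n)(v_1, ..., v_n) = det (dz^k (v_j)). *)
Definition Omega (w : 'I_n -> 'rV[R]_(n + n)) : R[i] :=
  \det (\matrix_(j < n, k < n) dz k (w j)).

Definition pullback (A : 'rV[R]_(n + n) -> 'rV[R]_(n + n))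
    (alpha : ('I_n -> 'rV[R]_(n + n)) -> R[i]) :
    ('I_n -> 'rV[R]_(n + n)) -> R[i] :=
  fun w => alpha (fun j => A (w j)).

Definition eball (r : R) : set 'rV[R]_(n + n) := [set x | enorm x <= r].

Definition cylinder (L : {vspace 'rV[R]_(n + n)}) (r : R) :
    set 'rV[R]_(n + n) :=
  [set x | enorm (proj L x) ^+ 2 <= r ^+ 2].

End SymplecticSpace.

(* Main.v *)
Require Import Defs.
From HB Require Import structures.
From mathcomp Require Import all_boot all_order all_algebra.
From mathcomp Require Import complex lra.
From mathcomp Require Import classical_sets reals.

Set Implicit Arguments.
Unset Strict Implicit.
Unset Printing Implicit Defensive.

Import Order.TTheory GRing.Theory Num.Theory.
Local Open Scope ring_scope.
Local Open Scope classical_set_scope.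

(** The form Omega is decomposable, so it remembers the complex structure: a
    real-linear map that preserves it is complex-linear, given by a complex
    matrix M, and then det M = 1 ([Omega_preserving_complex_linear]).  This
    turns the statement into an upper bound for |det M|.

    Since L is Lagrangian, the Hermitian product of two vectors of L is their
    real scalar product; an orthonormal basis e_1, ..., e_n of L over the reals
    is therefore a unitary basis of C^n.  Let A^* be the Hermitian adjoint of A
    and v_k = A^* e_k.  Then |v_k|^2 = <A v_k, e_k>, and since e_k is a unit
    vector of L, the hypothesis on the ball bounds <A z, e_k> by
    (rho / r) |z| ([ball_in_cylinder_bound]).  Taking z = v_k gives
    |v_k| <= rho / r for every k.

    The vectors v_1, ..., v_n are the rows of a matrix whose determinant has
    modulus |det M| = 1, so Hadamard's inequality ([hadamard]) yields
    1 <= (rho / r)^(2 n), that is r <= rho.  Note that each v_k is controlled by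
    a single real functional, the real part of <A z, e_k>: complex linearity is
    what upgrades this to a bound on the complex row. *)

(** * Determinants *)

(** Laplace expansion along row j: the cofactors of row j do not see row j. *)
Lemma det_replace_row (K : comNzRingType) (n : nat) (M : 'M[K]_n)
    (u : 'rV[K]_n) (j : 'I_n) :
  \det (\matrix_(i, k) if i == j then u 0 k else M i k) = (u *m \adj M) 0 j.
Proof.
rewrite (expand_det_row _ j) mxE; apply: eq_bigr => k _.
rewrite !mxE eqxx; congr (_ * (_ * \det _)); apply/matrixP => a b.
by rewrite !mxE eq_sym (negbTE (neq_lift _ _)).
Qed.

Section Hadamard.
Variable C : numClosedFieldType.
Local Open Scope sesquilinear_scope.

Lemma dotmx_adjoint (m n : nat) (u : 'rV[C]_m) (w : 'rV[C]_n)
    (M : 'M[C]_(m, n)) :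
  dotmx (u *m M) w = dotmx u (w *m M ^t*).
Proof. by rewrite !dotmxE trmx_mul map_mxM trmxCK mulmxA. Qed.

Lemma norm_det_unitary (n : nat) (U : 'M[C]_n) :
  U \is unitarymx -> `|\det U| = 1.
Proof.
move=> /unitarymxP/(congr1 determinant); rewrite det_mulmx det1.
rewrite det_map_mx det_tr -normCK => /eqP.
by rewrite sqrp_eq1 // => /eqP.
Qed.

(** Gram-Schmidt factors M as T S with S unitary and T lower triangular.  The
    diagonal entries of T are the scalar products of the rows of M with unit
    vectors, so Cauchy-Schwarz bounds each of them by the norm of a row. *)
Lemma hadamard (n : nat) (M : 'M[C]_n) :
  `|\det M| ^+ 2 <= \prod_i dotmx (row i M) (row i M).
Proof.
pose S := schmidt M; pose T := M *m S ^t*.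
have SU : S \is unitarymx by apply: schmidt_unitarymx.
have Sdot : forall i j, dotmx (row i S) (row j S) = (i == j)%:R.
  exact/row_unitarymxP.
have TE i j : T i j = dotmx (row i M) (row j S).
  by rewrite dotmxE !mxE; apply: eq_bigr => k _; rewrite !mxE.
have Ttrig : is_trig_mx T.
  apply/is_trig_mxP => i j ij; rewrite TE.
  (* row i of M lies in the span of the rows k <= i of S, all orthogonal to
     row j since i < j *)
  have /submx_trans/(_ _)/sub_kermxP := row_schmidt_sub M i.
  rewrite -/S dotmxE => /(_ _ ((row j S) ^t*)) ->; first by rewrite mxE.
  apply/sumsmx_subP => k ki; rewrite genmxE; apply/sub_kermxP.
  apply/matrixP => x y; rewrite !ord1 -dotmxE Sdot mxE.
  by rewrite -val_eqE /= ltn_eqF // (leq_ltn_trans ki).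
rewrite -{1}(mulmxKtV M SU erefl) det_mulmx -/T normrM.
rewrite (norm_det_unitary SU) mulr1.
rewrite det_trig // normr_prod -prodrXl; apply: ler_prod => i _.
rewrite exprn_ge0 //= TE.
have [+ _] := CauchySchwarz (@dotmx C n) (row i M) (row i S).
by rewrite /= Sdot eqxx mulr1.
Qed.

End Hadamard.

(** * Complex coordinates and maps preserving Omega *)

Section ComplexCoordinates.
Variables (R : realType) (n : nat).
Implicit Types (u v : 'rV[R]_(n + n)) (h : 'rV[R[i]]_n).
Local Open Scope complex_scope.
Local Open Scope sesquilinear_scope.

Definition zvec v : 'rV[R[i]]_n := \row_k dz k v.

Definition realify h : 'rV[R]_(n + n) :=
  row_mx (\row_k complex.Re (h 0 k)) (\row_k complex.Im (h 0 k)).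

Lemma realifyK : cancel realify zvec.
Proof.
move=> h; apply/rowP => k.
rewrite mxE /dz /xcoord /ycoord row_mxEl row_mxEr !mxE.
by case: (h 0 k).
Qed.

(** The Hermitian product packages the metric and the symplectic form; the
    minus sign comes from conjugating the second argument. *)
Lemma dotmx_zvec u v : dotmx (zvec u) (zvec v) = dotv u v -i* omega u v.
Proof.
have sumC (F G : 'I_n -> R) :
    \sum_k (F k +i* G k) = (\sum_k F k) +i* (\sum_k G k).
  by elim/big_rec3: _ => // k a b _ _ ->.
rewrite dotmxE mxE /dotv big_split_ord /= -big_split /omega -sumrN -sumC.
apply: eq_bigr => k _; rewrite !mxE /dz /xcoord /ycoord /=.
apply/eqP; rewrite eq_complex /= !mulrN opprK opprD opprK.
by rewrite addrC addrC eqxx addrC eqxx.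
Qed.

Lemma omega_diag v : omega v v = 0.
Proof. by rewrite /omega big1 // => k _; rewrite mulrC subrr. Qed.

Lemma Omega_zvec (w : 'I_n -> 'rV[R]_(n + n)) :
  Omega w = \det (\matrix_(j, k) zvec (w j) 0 k).
Proof. by congr (\det _); apply/matrixP => j k; rewrite !mxE. Qed.

(** The rows of M are the images of the standard complex basis e_j.  By Cramer's
    rule, the coordinates of A v on these rows are the values of Omega on
    A e_1, ..., A v, ..., A e_n (with A v in place j); as A preserves Omega, they
    are the values on e_1, ..., v, ..., e_n, which are the coordinates of v. *)
Lemma Omega_preserving_complex_linear
    (A : {linear 'rV[R]_(n + n) -> 'rV[R]_(n + n)}) :
  pullback A (@Omega R n) =1 @Omega R n ->
  exists2 M : 'M[R[i]]_n, \det M = 1 & forall v, zvec (A v) = zvec v *m M.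
Proof.
move=> A_Omega.
pose e (j : 'I_n) := realify (delta_mx 0 j).
pose M := \matrix_(j, k) zvec (A (e j)) 0 k.
have detM : \det M = 1.
  rewrite -[RHS](det1 _ n) -(Omega_zvec (fun j => A (e j))).
  rewrite [LHS](A_Omega e) Omega_zvec; congr (\det _).
  by apply/matrixP => j k; rewrite mxE realifyK !mxE eqxx eq_sym.
exists M => // v.
have adjM : zvec (A v) *m \adj M = zvec v *m \adj 1%:M.
  apply/rowP => j; rewrite -!det_replace_row.
  pose w i := if i == j then v else e i.
  have := A_Omega w; rewrite /pullback !Omega_zvec => Aw.
  transitivity (\det (\matrix_(i, k) zvec (A (w i)) 0 k)).
    by congr (\det _); apply/matrixP => i k; rewrite !mxE /w; case: ifP.
  rewrite Aw; congr (\det _); apply/matrixP => i k; rewrite mxE [RHS]mxE /w.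
  by case: ifP => // _; rewrite realifyK !mxE eqxx eq_sym.
have adj1 : \adj 1%:M = 1%:M :> 'M[R[i]]_n.
  by rewrite -[LHS]mul1mx mul_mx_adj det1.
by rewrite -[LHS]mulmx1 -detM -mul_adj_mx mulmxA adjM adj1 mulmx1.
Qed.

End ComplexCoordinates.

(** * Euclidean geometry of the ball and the cylinder *)

Section Euclidean.
Variables (R : realType) (m : nat).
Implicit Types (u v : 'rV[R]_m) (L : {vspace 'rV[R]_m}).

Lemma sqr_enorm v : enorm v ^+ 2 = dotv v v.
Proof. by rewrite sqr_sqrtr // sumr_ge0 // => i _; apply: sqr_ge0. Qed.

Lemma enormZ (a : R) v : 0 <= a -> enorm (a *: v) = a * enorm v.
Proof.
move=> a0; rewrite /enorm linearZl_LR linearZr_LR /= mulrA -expr2.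
by rewrite sqrtrM ?sqr_ge0 // sqrtr_sqr ger0_norm.
Qed.

Lemma enormN v : enorm (- v) = enorm v.
Proof. by rewrite /enorm linearNl linearNr opprK. Qed.

(** Expand 0 <= |u - <u, v> v|^2. *)
Lemma normr_dotv_le_enorm u v : dotv v v = 1 -> `|dotv u v| <= enorm u.
Proof.
move=> vv1; rewrite -sqrtr_sqr ler_wsqrtr //.
pose t := dotv u v; rewrite -/t -subr_ge0.
have : 0 <= dotv (u - t *: v) (u - t *: v).
  by apply: sumr_ge0 => i _; apply: sqr_ge0.
rewrite linearBl linearBr linearBr !linearZl_LR !linearZr_LR /= vv1 (dotvC v).
by rewrite -/t mulr1 -expr2 subrr subr0.
Qed.

(** Induction on k: normalise a nonzero vector of L and recurse in its orthogonal
    complement inside L, whose dimension drops by at most one. *)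
Lemma orthonormal_family (k : nat) L :
  (k <= \dim L)%N ->
  exists2 e : 'I_k -> 'rV[R]_m, forall i, e i \in L &
    forall i j, dotv (e i) (e j) = (i == j)%:R.
Proof.
elim: k L => [|k IHk] L kL; first by exists (fun _ => 0) => -[].
have u_neq0 : vpick L != 0.
  by rewrite vpick0 -dimv_eq0 -lt0n (leq_ltn_trans _ kL).
pose u := vpick L; have uu0 : 0 < dotv u u by apply: dotv_gt0.
pose c := (Num.sqrt (dotv u u))^-1; pose u1 := c *: u.
have u1u1 : dotv u1 u1 = 1.
  rewrite linearZl_LR linearZr_LR /= mulrA -expr2 exprVn sqr_sqrtr ?ltW //.
  by rewrite mulVf ?gt_eqF.
have [|e eL ee] := IHk (L :&: orthocomp <[u1]>)%VS.
  rewrite -ltnS (leq_trans kL) // -[X in (X <= _)%N]prednK.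
    by rewrite ltnS leq_dim_orthov1.
  exact: leq_ltn_trans kL.
have eu j : dotv (e j) u1 = 0.
  have := eL j; rewrite memv_cap => /andP[_ /mem_orthovP]; apply.
  exact: memv_line.
exists (fun i => if unlift ord0 i is Some j then e j else u1) => [i|i j].
  case: unliftP => [j|] _; last by rewrite memvZ // memv_pick.
  by have := eL j; rewrite memv_cap => /andP[].
case: unliftP => [i'|] ->; case: unliftP => [j'|] ->; rewrite ?ee //.
by rewrite dotvC eu.
Qed.

End Euclidean.

Section Cylinder.
Variables (R : realType) (n : nat).
Implicit Types (L : {vspace 'rV[R]_(n + n)}) (e v x : 'rV[R]_(n + n)).

Lemma cylinder_slab L (rho : R) e x :
  0 <= rho -> e \in L -> dotv e e = 1 -> cylinder L rho x ->
  `|dotv x e| <= rho.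
Proof.
move=> rho0 eL ee1; rewrite /cylinder /= ler_sqr ?nnegrE ?sqrtr_ge0 // => xrho.
rewrite -(subrK (proj L x) x) linearDl /= orthoproj_orthogonal // add0r.
exact: le_trans (normr_dotv_le_enorm _ ee1) xrho.
Qed.

(** The ball is symmetric under z |-> - z, so averaging the constraints at z and
    - z removes the translation b; homogeneity then gives the bound at every v. *)
Lemma ball_in_cylinder_bound (A : {linear 'rV[R]_(n + n) -> 'rV[R]_(n + n)})
    (b : 'rV[R]_(n + n)) L (r rho : R) e v :
  0 <= r -> 0 <= rho ->
  (fun z => A z + b) @` @eball R n r `<=` cylinder L rho ->
  e \in L -> dotv e e = 1 -> r * dotv (A v) e <= rho * enorm v.
Proof.
move=> r0 rho0 sub eL ee1.
have [->|v0] := eqVneq v 0.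
  by rewrite linear0 linear0l mulr0 mulr_ge0 // sqrtr_ge0.
have nv0 : 0 < enorm v by rewrite sqrtr_gt0 dotv_gt0.
pose z := (r / enorm v) *: v.
have zr : enorm z = r.
  by rewrite enormZ ?divr_ge0 ?sqrtr_ge0 // divfK ?gt_eqF.
have slab y : enorm y = r -> `|dotv (A y) e + dotv b e| <= rho.
  move=> yr; rewrite -linearDl /=; apply: cylinder_slab eL ee1 _ => //.
  by apply: sub; exists y => //; rewrite /eball /= yr.
have Nzr : enorm (- z) = r by rewrite enormN.
have Az : dotv (A z) e <= rho.
  have := slab _ Nzr; have := slab _ zr.
  rewrite linearN linearNl /= !ler_norml.
  by move=> /andP[_ ?] /andP[? _]; lra.
by move: Az; rewrite linearZ linearZl_LR /= mulrAC ler_pdivrMr.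
Qed.

End Cylinder.

(** * The non-squeezing theorem *)

Theorem theorem5p9 (R : realType) (n : nat) (n_gt0 : (0 < n)%N)
    (r rho : R) (r_gt0 : 0 < r) (rho_gt0 : 0 < rho)
    (A : {linear 'rV[R]_(n + n) -> 'rV[R]_(n + n)}) (b : 'rV[R]_(n + n))
    (A_Omega : pullback A (@Omega R n) =1 @Omega R n)
    (L : {vspace 'rV[R]_(n + n)}) (L_lagrangian : lagrangian L) :
  (fun z => A z + b) @` @eball R n r `<=` cylinder L rho -> r <= rho.
Proof.
move=> sub.
have [M detM AM] := Omega_preserving_complex_linear A_Omega.
have [dimL omegaL] := L_lagrangian.
have [|e eL ee] := @orthonormal_family R _ n L; first by rewrite dimL.
pose V := \matrix_j zvec (e j).
have V_unitary : V \is unitarymx.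
  apply/row_unitarymxP => i j; rewrite !rowK dotmx_zvec ee omegaL //.
  by rewrite oppr0 -[LHS]/(real_complex _ _) rmorph_nat.
(* row j of H is the Hermitian adjoint of A applied to e j *)
pose H := V *m (map_mx Num.conj M^T).
have detH : `|\det H| = 1.
  rewrite det_mulmx normrM norm_det_unitary // mul1r.
  by rewrite det_map_mx det_tr detM rmorph1 normr1.
have rowH j : dotmx (row j H) (row j H) <= real_complex R ((rho / r) ^+ 2).
  pose v := realify (row j H).
  have vE : zvec v = row j H by rewrite realifyK.
  have vAe : dotv (A v) (e j) = enorm v ^+ 2.
    have HE : row j H = zvec (e j) *m map_mx Num.conj M^T.
      by rewrite row_mul rowK.
    have := dotmx_adjoint (row j H) (zvec (e j)) M.
    by rewrite -HE -vE -AM !dotmx_zvec sqr_enorm => -[].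
  have ejej : dotv (e j) (e j) = 1 by rewrite ee eqxx.
  have := ball_in_cylinder_bound v (ltW r_gt0) (ltW rho_gt0) sub (eL j) ejej.
  rewrite vAe expr2 mulrA => le_v.
  have {}le_v : enorm v <= rho / r.
    have := sqrtr_ge0 (dotv v v).
    rewrite -/(enorm v) le_eqVlt => /predU1P[<-|v_gt0].
      by rewrite divr_ge0 ?ltW.
    by rewrite ler_pdivlMr // mulrC -(ler_pM2r v_gt0).
  rewrite -vE dotmx_zvec omega_diag lecE /= oppr0 eqxx /= -sqr_enorm.
  by rewrite ler_sqr ?nnegrE ?sqrtr_ge0 // divr_ge0 ?ltW.
have : 1 <= ((rho / r) ^+ 2) ^+ n.
  rewrite -(@lecR R) rmorph1 rmorphXn /=.
  have := hadamard H; rewrite detH expr1n => /le_trans; apply.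
  rewrite -[n in X in _ <= X]card_ord -prodr_const; apply: ler_prod => j _.
  by rewrite dnorm_ge0 rowH.
rewrite !expr_ge1 ?exprn_ge0 ?divr_ge0 ?(ltW r_gt0) ?(ltW rho_gt0) //.
by rewrite ler_pdivlMr ?mul1r.
Qed.
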